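(* Let $f(x)=x^TAx+2a^Tx+c$ and $h(x)=x^TBx+2b^Tx+d$ be quadratic functions on $\mathbb{R}^n$, where $A,B$ are real symmetric $n\times n$ matrices, $a,b\in\mathbb{R}^n$ and $c,d\in\mathbb{R}$, and suppose $\{x\in\mathbb{R}^n:h(x)=0\}\neq\emptyset$. Then the statement $$\text{for all }x\in\mathbb{R}^n,\quad h(x)=0\ \Longrightarrow\ f(x)\ge 0$$ is true if and only if for every $\epsilon>0$ there exists $\lambda_\epsilon\in\mathbb{R}$ such that $$f(x)+\lambda_\epsilon\,(h(x))^{\phi(B)}+\epsilon(x^Tx+1)\ge 0\quad\text{for all }x\in\mathbb{R}^n,$$ where $\phi(B)=1$ if $B\neq 0$ and $\phi(B)=2$ if $B=0$. *)

(* Defs.v *)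
From mathcomp Require Import all_boot all_order all_algebra.
From mathcomp Require Import reals.

Set Implicit Arguments.
Unset Strict Implicit.
Unset Printing Implicit Defensive.

Import GRing.Theory Num.Theory.
Local Open Scope ring_scope.

(* x^T P x + 2 p^T x + r; [0 0] extracts the entry of a 1 x 1 matrix. *)
Definition quadfun (R : realType) (n : nat) (P : 'M[R]_n) (p : 'cV[R]_n)
    (r : R) (x : 'cV[R]_n) : R :=
  (x^T *m P *m x) 0 0 + 2 * (p^T *m x) 0 0 + r.

Definition phi (R : realType) (n : nat) (B : 'M[R]_n) : nat :=
  if B == 0 then 2%N else 1%N.

(* Main.v *)
(* If [h] takes both signs and [B != 0], then no [eps] is needed: a valid [lam] is
   any number separating the ratios [- f x / h x] over [h x > 0] from those over
   [h x < 0]. These are ordered because on the line through two such points [h]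
   has two roots, where [f] is nonnegative.
   Otherwise [h] keeps its sign, up to which, with [y] a zero of [h],
   [h (y + x) = dot x (P x)] for a positive semidefinite [P]; if [B = 0] the same
   holds for [h ^+ 2]. Then [f] is nonnegative on [y + ker P], and the component
   of [x] outside [ker P] is controlled by [dot x (P x)]. *)
Require Import Defs.
From mathcomp Require Import all_boot all_order all_algebra.
From mathcomp Require Import boolp classical_sets reals ring lra.

Set Implicit Arguments.
Unset Strict Implicit.
Unset Printing Implicit Defensive.

Import Order.TTheory GRing.Theory Num.Theory.
Local Open Scope ring_scope.

(** * Dot products and quadratic functions along lines *)

Definition dot (R : realType) (n : nat) (x y : 'cV[R]_n) : R :=
  (x^T *m y) 0 0.

Lemma dotE (R : realType) (n : nat) (x y : 'cV[R]_n) :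
  dot x y = \sum_i x i 0 * y i 0.
Proof. by rewrite /dot mxE; apply: eq_bigr => i _; rewrite mxE. Qed.

Lemma dotC (R : realType) (n : nat) (x y : 'cV[R]_n) : dot x y = dot y x.
Proof. by rewrite !dotE; apply: eq_bigr => i _; rewrite mulrC. Qed.

Lemma dotDl (R : realType) (n : nat) (x y z : 'cV[R]_n) :
  dot (x + y) z = dot x z + dot y z.
Proof. by rewrite /dot linearD mulmxDl mxE. Qed.

Lemma dotDr (R : realType) (n : nat) (x y z : 'cV[R]_n) :
  dot x (y + z) = dot x y + dot x z.
Proof. by rewrite /dot mulmxDr mxE. Qed.

Lemma dotZl (R : realType) (n : nat) (k : R) (x y : 'cV[R]_n) :
  dot (k *: x) y = k * dot x y.
Proof. by rewrite /dot linearZ /= -scalemxAl mxE. Qed.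

Lemma dotZr (R : realType) (n : nat) (k : R) (x y : 'cV[R]_n) :
  dot x (k *: y) = k * dot x y.
Proof. by rewrite /dot -scalemxAr mxE. Qed.

Lemma dot_mulmxl (R : realType) (m n : nat) (M : 'M[R]_(m, n))
    (x : 'cV[R]_n) (y : 'cV[R]_m) : dot (M *m x) y = dot x (M^T *m y).
Proof. by rewrite /dot trmx_mul mulmxA. Qed.

Lemma dot_sym (R : realType) (n : nat) (M : 'M[R]_n) (x y : 'cV[R]_n) :
  M^T = M -> dot y (M *m x) = dot x (M *m y).
Proof. by move=> symM; rewrite dotC dot_mulmxl symM. Qed.

Lemma dot_outer (R : realType) (n : nat) (a x : 'cV[R]_n) :
  dot x (a *m a^T *m x) = dot a x ^+ 2.
Proof.
by rewrite -mulmxA /dot mulmxA mxE big_ord1 expr2 -/(dot x a) dotC.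
Qed.

Lemma dotxx_ge0 (R : realType) (n : nat) (x : 'cV[R]_n) : 0 <= dot x x.
Proof. by rewrite dotE; apply: sumr_ge0 => i _; rewrite -expr2 sqr_ge0. Qed.

Lemma dotxx_eq0 (R : realType) (n : nat) (x : 'cV[R]_n) :
  dot x x = 0 -> x = 0.
Proof.
rewrite dotE => /eqP; rewrite psumr_eq0 => [/allP x0|i _]; last first.
  by rewrite -expr2 sqr_ge0.
apply/colP => i; rewrite mxE; apply/eqP.
by have := x0 i (mem_index_enum i); rewrite /= -expr2 sqrf_eq0.
Qed.

Lemma quadfunE (R : realType) (n : nat) (P : 'M[R]_n) (p : 'cV[R]_n) (r : R)
    (x : 'cV[R]_n) : quadfun P p r x = dot x (P *m x) + 2 * dot p x + r.
Proof. by rewrite /quadfun /dot mulmxA. Qed.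

Lemma quadfun_line (R : realType) (n : nat) (P : 'M[R]_n) (p : 'cV[R]_n)
    (r : R) (x v : 'cV[R]_n) (s : R) : P^T = P ->
  quadfun P p r (x + s *: v) =
  quadfun P p r x + s * (2 * dot v (P *m x + p)) + s ^+ 2 * dot v (P *m v).
Proof.
move=> symP.
rewrite !quadfunE mulmxDr -scalemxAr !(dotDl, dotDr, dotZl, dotZr).
rewrite (dot_sym x v symP) (dot_sym v x symP) (dotC p v); ring.
Qed.

(** * Bounds on quadratic forms and the semidefinite penalty *)

Lemma form_bound (R : realType) (n : nat) (M : 'M[R]_n) :
  exists2 K : R, 0 < K & forall x, dot x (M *m x) <= K * dot x x.
Proof.
exists (1 + \sum_i \sum_j `|M i j|) => [|x].
  by rewrite ltr_pwDl// sumr_ge0// => i _; rewrite sumr_ge0.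
rewrite mulrDl mul1r ler_wpDl ?dotxx_ge0//.
rewrite {1}dotE mulr_suml ler_sum// => i _.
rewrite mxE mulr_sumr mulr_suml ler_sum// => j _.
have sqle k : x k 0 ^+ 2 <= dot x x.
  rewrite dotE (bigD1 k)//= -expr2 lerDl sumr_ge0// => l _.
  by rewrite -expr2 sqr_ge0.
apply: le_trans (ler_norm _) _; rewrite mulrCA normrM ler_wpM2l//.
(* The two squares give [|x_i x_j| <= (x_i^2 + x_j^2) / 2], which is at most [dot x x]. *)
have := sqle i; have := sqle j; have := sqr_ge0 (x i 0 - x j 0).
have := sqr_ge0 (x i 0 + x j 0).
rewrite ler_norml; move: (dot x x) => D; nra.
Qed.

(** Evaluate the form at [x - K^-1 P x], with [K] bounding the form of [P]: the second-order term is
    at most [K^-1 |P x|^2], half the size of the first-order one, so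
    [0 <= dot x (P x) - K^-1 |P x|^2]. *)
Lemma psd_image_bound (R : realType) (n : nat) (P : 'M[R]_n) : P^T = P ->
  (forall x, 0 <= dot x (P *m x)) ->
  exists2 K : R, 0 < K &
    forall x, dot (P *m x) (P *m x) <= K * dot x (P *m x).
Proof.
move=> symP psdP; have [K K0 hK] := form_bound P.
exists K => // x.
have := psdP (x + (- K^-1) *: (P *m x)); have := hK (P *m x).
rewrite mulmxDr -scalemxAr !(dotDl, dotDr, dotZl, dotZr).
rewrite (dot_sym (P *m x) x symP).
move: (dot (P *m x) (P *m x)) (dot x (P *m x)) => D X.
move: (dot _ _) => Y YKD.
have -> : X + - K^-1 * D + (- K^-1 * D + - K^-1 * (- K^-1 * Y)) =
  (K * X - 2 * D + K^-1 * Y) / K by field; rewrite gt_eqF.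
rewrite pmulr_lge0 ?invr_gt0// => le0.
have : K^-1 * Y <= D by rewrite mulrC ler_pdivrMr// mulrC.
lra.
Qed.

(* The part [w] of [x] outside the kernel of [P] is a linear image of [P x], so
   by Young's inequality it costs [eps] plus a multiple of [dot x (P x)]. *)
Lemma psd_penalty (R : realType) (n : nat) (A P : 'M[R]_n) (a y : 'cV[R]_n)
    (c eps : R) : A^T = A -> P^T = P -> (forall x, 0 <= dot x (P *m x)) ->
  (forall u, P *m u = 0 -> 0 <= quadfun A a c (y + u)) -> 0 < eps ->
  exists lam : R, forall x,
    0 <= quadfun A a c (y + x) + lam * dot x (P *m x) +
         eps * (dot (y + x) (y + x) + 1).
Proof.
move=> symA symP psdP fker eps0.
have [K' K'0 hK'] := psd_image_bound symP psdP.
(* A generalized inverse: [x - N P x] lies in the kernel of [P]. *)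
have [N PNP] : exists N, P *m N *m P = P.
  by exists (pinvmx P); rewrite mulmxKpV ?submx_refl.
(* Nonnegativity of the quadratic function at [X - w] bounds its value at [X] below by
   [2 X.Aw + 2 a.w - w.Aw]. Completing squares, [eps |X|^2] absorbs the first term at cost
   [eps^-1 |Aw|^2] and [eps] the second at cost [eps^-1 (a.w)^2]; [Q] collects these costs and
   [w.Aw]. *)
pose Q := A + eps^-1 *: (A *m A) + eps^-1 *: (a *m a^T).
have [K K0 hK] := form_bound (N^T *m Q *m N).
exists (K * K') => x; have [X XE] : exists X, X = y + x by exists (y + x).
rewrite -XE; pose w := N *m (P *m x).
have : 0 <= quadfun A a c (X + (-1) *: w).
  rewrite XE -addrA scaleN1r; apply: fker.
  by rewrite mulmxBr /w !mulmxA PNP subrr.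
rewrite quadfun_line// dotDr (dot_sym X w symA).
have wQ : dot w (Q *m w) <= K * K' * dot x (P *m x).
  apply: le_trans (_ : K * dot (P *m x) (P *m x) <= _).
    by have := hK (P *m x); rewrite -!mulmxA -/w dotC dot_mulmxl trmxK dotC.
  by rewrite -mulrA ler_pM2l.
have : dot w (Q *m w) = dot w (A *m w) + eps^-1 * dot (A *m w) (A *m w)
    + eps^-1 * dot a w ^+ 2.
  rewrite /Q !mulmxDl -!scalemxAl !(dotDr, dotZr) dot_outer.
  by rewrite (dot_mulmxl A) symA mulmxA.
have := dotxx_ge0 (X + eps^-1 *: (A *m w)).
rewrite !(dotDl, dotDr, dotZl, dotZr) (dotC (A *m w) X) (dotC w a).
have := sqr_ge0 (1 + eps^-1 * dot a w).
move: wQ; move: (dot w (Q *m w)) (dot w (A *m w)) (dot (A *m w) (A *m w)).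
move: (dot a w) (dot X (A *m w)) (dot X X) (K * K' * _) (quadfun _ _ _ _).
move=> aw XAw XX L fX wQw wAw AA leL sq1 sq2 eQ le0.
have {}sq1 : 0 <= eps + 2 * aw + eps^-1 * aw ^+ 2.
  have -> : eps + 2 * aw + eps^-1 * aw ^+ 2 = eps * (1 + eps^-1 * aw) ^+ 2.
    by field; rewrite gt_eqF.
  by rewrite mulr_ge0// ltW.
have {}sq2 : 0 <= eps * XX + 2 * XAw + eps^-1 * AA.
  have -> : eps * XX + 2 * XAw + eps^-1 * AA =
     eps * (XX + eps^-1 * XAw + (eps^-1 * XAw + eps^-1 * (eps^-1 * AA))).
    by field; rewrite gt_eqF.
  by rewrite mulr_ge0// ltW.
lra.
Qed.

(** * Constraints taking both signs *)

(* The roots of [h0 (1+s)^2 + h1 s (1+s) + h2 s^2] have opposite signs; the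
   positive combination of the values of [f] at them that cancels the linear
   term is the claim. The root [s = -1], sent to infinity by [s / (1 + s)], is
   excluded by [h2 != 0]. *)
Lemma quadratic_pair (R : realType) (f0 f1 f2 h0 h1 h2 : R) : h2 != 0 ->
  (forall t, h0 + t * h1 + t ^+ 2 * h2 = 0 -> 0 <= f0 + t * f1 + t ^+ 2 * f2) ->
  0 < h0 -> h0 + h1 + h2 < 0 ->
  0 <= h0 * (f0 + f1 + f2) - (h0 + h1 + h2) * f0.
Proof.
move=> h2n0 hf h0gt hlt.
(* Expanded in powers of [s], the polynomial is [h0 + 2 m s - q s^2], with [q > 0] and [h0 > 0]. *)
pose q := - (h0 + h1 + h2); pose m := h0 + h1 / 2.
have q0 : 0 < q by rewrite oppr_gt0.
have fs s : h0 + 2 * m * s - q * s ^+ 2 = 0 ->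
    0 <= f0 + s * (2 * f0 + f1) + s ^+ 2 * (f0 + f1 + f2).
  move=> hs; have s1 : 1 + s != 0.
    apply: contra_neq h2n0 => s1; have {}s1 : s = -1 by lra.
    by move: hs; rewrite s1 /m /q; lra.
  have -> : f0 + s * (2 * f0 + f1) + s ^+ 2 * (f0 + f1 + f2) =
     (1 + s) ^+ 2 * (f0 + (s / (1 + s)) * f1 + (s / (1 + s)) ^+ 2 * f2).
    by field.
  apply: mulr_ge0; first exact: sqr_ge0.
  apply: hf; rewrite -[LHS](mulKf (expf_neq0 2 s1)).
  apply/eqP; rewrite mulf_eq0; apply/orP; right; apply/eqP.
  by rewrite -hs /m /q; field.
have qE : q = - (h0 + h1 + h2) by [].
clearbody q m; pose D := Num.sqrt (m ^+ 2 + q * h0).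
have qh : 0 < q * h0 by rewrite mulr_gt0.
have D2 : D ^+ 2 = m ^+ 2 + q * h0 by rewrite sqr_sqrtr; nra.
have D0 : 0 <= D by exact: sqrtr_ge0.
clearbody D.
have mD : m < D by nra.
have mD' : - D < m by nra.
have root e : e ^+ 2 = D ^+ 2 ->
    h0 + 2 * m * ((m + e) / q) - q * ((m + e) / q) ^+ 2 = 0.
  move=> e2; have -> : h0 + 2 * m * ((m + e) / q) - q * ((m + e) / q) ^+ 2 =
    (q * h0 + m ^+ 2 - e ^+ 2) / q by field; rewrite gt_eqF.
  by rewrite e2 D2; field; rewrite gt_eqF.
have := fs _ (root D erefl); have := fs _ (root (- D) (sqrrN D)).
set s1 := (m + - D) / q; set s2 := (m + D) / q => fs1 fs2.
have s1lt : 0 < - s1 by rewrite oppr_gt0 ltr_pdivrMr//; lra.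
have s2gt : 0 < s2 by rewrite divr_gt0//; lra.
have s12 : q * (s1 * s2) = - h0.
  have -> : q * (s1 * s2) = (m ^+ 2 - D ^+ 2) / q.
    by rewrite /s1 /s2; field; rewrite gt_eqF.
  by rewrite D2; field; rewrite gt_eqF.
have := addr_ge0 (mulr_ge0 (ltW s2gt) fs1) (mulr_ge0 (ltW s1lt) fs2).
have -> : s2 * (f0 + s1 * (2 * f0 + f1) + s1 ^+ 2 * (f0 + f1 + f2)) +
    - s1 * (f0 + s2 * (2 * f0 + f1) + s2 ^+ 2 * (f0 + f1 + f2)) =
    (s2 - s1) * (f0 - s1 * s2 * (f0 + f1 + f2)) by ring.
rewrite pmulr_rge0; last lra.
move=> /(mulr_ge0 (ltW q0)).
by rewrite mulrBr (mulrA q) s12 mulNr opprK qE addrC mulNr.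
Qed.

(** If the form vanishes identically, expanding it at [x + B x] leaves [2 |B x|^2 = 0]. *)
Lemma sym_form_neq0 (R : realType) (n : nat) (B : 'M[R]_n) : B^T = B ->
  B != 0 -> exists v, dot v (B *m v) != 0.
Proof.
move=> symB; apply: contra_neqP => /forallNP B0.
have {}B0 v : dot v (B *m v) = 0 by apply/eqP/negP => /negP; exact: B0.
have Bx (x : 'cV[R]_n) : B *m x = 0.
  apply: dotxx_eq0; have := B0 (x + B *m x).
  rewrite mulmxDr !(dotDl, dotDr) !B0 (dot_sym (B *m x) x symB); lra.
apply/matrixP => i j.
by have /colP/(_ i) := Bx (delta_mx j 0); rewrite -colE !mxE.
Qed.

Lemma quadratic_gt0_near0 (R : realType) (a0 a1 a2 : R) : 0 < a0 ->
  exists2 d : R, 0 < d & forall s, 0 < s <= d -> 0 < a0 + s * a1 + s ^+ 2 * a2.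
Proof.
(* Since [a0 <= C], the bound [s <= a0 / (2 C)] gives [s <= 1], so the perturbation is at most
   [s C <= a0 / 2]. *)
move=> a0gt; pose C := a0 + `|a1| + `|a2|.
have C0 : a0 <= C by rewrite /C -addrA lerDl addr_ge0.
exists (a0 / (2 * C)) => [|s /andP[s0]]; first by rewrite divr_gt0//; lra.
rewrite ler_pdivlMr; last lra.
move=> sd; have s1 : s <= 1 by nra.
have := normr_ge0 a1; have := normr_ge0 a2.
have := ler_norm (- a1); have := ler_norm (- a2); rewrite !normrN.
move: C0 sd; rewrite /C; move: `|a1| `|a2| => b1 b2; nra.
Qed.

(* Perturbing [x] along [v] makes the quadratic coefficient of [h] along the
   line through [x] and [y] nonzero. *)
Lemma quadfun_pair (R : realType) (n : nat) (A B : 'M[R]_n) (a b : 'cV[R]_n)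
    (c d : R) (x y : 'cV[R]_n) : A^T = A -> B^T = B -> B != 0 ->
  (forall x, quadfun B b d x = 0 -> 0 <= quadfun A a c x) ->
  0 < quadfun B b d x -> quadfun B b d y < 0 ->
  0 <= quadfun B b d x * quadfun A a c y - quadfun B b d y * quadfun A a c x.
Proof.
move=> symA symB Bn0 hf hx hy.
have lineB z v s := quadfun_line b d z v s symB.
have lineA z v s := quadfun_line a c z v s symA.
have pair z : 0 < quadfun B b d z -> dot (y - z) (B *m (y - z)) != 0 ->
    0 <= quadfun B b d z * quadfun A a c y - quadfun B b d y * quadfun A a c z.
  move=> hz n0.
  have ey P p r : P^T = P -> quadfun P p r y = quadfun P p r z +
      2 * dot (y - z) (P *m z + p) + dot (y - z) (P *m (y - z)).
    move=> symP; have := quadfun_line p r z (y - z) 1 symP.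
    by rewrite scale1r addrC subrK mul1r expr1n mul1r.
  rewrite (ey A)// (ey B)//; apply: quadratic_pair => //; last by rewrite -ey.
  by move=> t; rewrite -lineB -lineA => /hf.
have [v vn0] := sym_form_neq0 symB Bn0.
rewrite leNgt; apply/negP => lt0.
have [d1 d1gt hd1] := quadratic_gt0_near0 (2 * dot v (B *m x + b)) (dot v (B *m v)) hx.
(* [g1] and [g2] are the coefficients of [s] and [s^2] in the negated target with [x] replaced by
   [x + s v]; by [hd2] the target stays negative for small [s], contradicting [pair] unless the
   leading coefficient of [h] is zero. *)
pose g1 := quadfun B b d y * (2 * dot v (A *m x + a)) -
  quadfun A a c y * (2 * dot v (B *m x + b)).
pose g2 := quadfun B b d y * dot v (A *m v) - quadfun A a c y * dot v (B *m v).
have [d2 d2gt hd2] := quadratic_gt0_near0 g1 g2 (etrans (oppr_gt0 _) lt0).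
pose dd := Num.min d1 d2.
have dd0 : 0 < dd by rewrite lt_min d1gt.
have no s : 0 < s <= dd -> dot (y - (x + s *: v)) (B *m (y - (x + s *: v))) = 0.
  rewrite le_min => /and3P[s0 s1 s2]; apply/eqP/negP => /negP n0.
  have sd1 : 0 < s <= d1 by rewrite s0.
  have sd2 : 0 < s <= d2 by rewrite s0.
  have := pair (x + s *: v); rewrite lineB lineA => /(_ (hd1 _ sd1) n0).
  have := hd2 _ sd2; rewrite /g1 /g2; lra.
have E s : dot (y - (x + s *: v)) (B *m (y - (x + s *: v))) =
   dot (y - x) (B *m (y - x)) - 2 * s * dot v (B *m (y - x)) + s ^+ 2 * dot v (B *m v).
  rewrite opprD addrA; move: (y - x) => e.
  rewrite -scaleNr mulmxDr -scalemxAr !(dotDl, dotDr, dotZl, dotZr).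
  rewrite (dot_sym v e symB); ring.
(* A polynomial of degree at most two in [s] with three distinct zeros has zero leading coefficient,
   here [dot v (B v)]. *)
have := no dd; have := no (dd / 2); have := no (dd / 3); rewrite !E.
move: (dot _ _) (dot _ _) => e0 e1; move: (dot _ _) vn0 => e2 /eqP vn0.
move=> /(_ ltac:(lra)) E3 /(_ ltac:(lra)) E2 /(_ ltac:(lra)) E1.
apply: vn0; have : dd ^+ 2 * e2 = 0 by lra.
by move/eqP; rewrite mulf_eq0 sqrf_eq0 gt_eqF//= => /eqP.
Qed.

Lemma quadfun_indefinite (R : realType) (n : nat) (A B : 'M[R]_n)
    (a b : 'cV[R]_n) (c d : R) : A^T = A -> B^T = B -> B != 0 ->
  (forall x, quadfun B b d x = 0 -> 0 <= quadfun A a c x) ->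
  (exists x, 0 < quadfun B b d x) -> (exists y, quadfun B b d y < 0) ->
  exists lam : R, forall x, 0 <= quadfun A a c x + lam * quadfun B b d x.
Proof.
move=> symA symB Bn0 hf [x0 hx0] [y0 hy0].
pose f := quadfun A a c; pose h := quadfun B b d.
pose S := [set - f x / h x | x in [set x | 0 < h x]]%classic.
have ubS y : h y < 0 -> ubound S (- f y / h y).
  move=> hy _ [x hx <-]; have := quadfun_pair symA symB Bn0 hf hx hy.
  rewrite -/f -/h => le0.
  rewrite ler_pdivrMr// mulrAC ler_ndivlMr//; lra.
have S0 : (S !=set0)%classic by exists (- f x0 / h x0), x0.
(* [S] collects the lower bounds imposed on [lam]; [x0] makes it nonempty and [y0] bounds it above,
   so [sup S] is a genuine supremum. *)
exists (sup S) => x; rewrite -/(f x) -/(h x).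
have [hx|hx|hx] := ltgtP (h x) 0; last by rewrite hx mulr0 addr0; exact: hf.
- have := ge_sup S0 (ubS x hx); rewrite ler_ndivlMr//; lra.
- have : - f x / h x <= sup S.
    by apply: ub_le_sup; [exists (- f y0 / h y0); exact: ubS | exists x].
  rewrite ler_pdivrMr//; lra.
Qed.

(** * Constraints of one sign, and the equivalence *)

(** A zero of a nonnegative function is a minimum, so the gradient at [y] vanishes and only the
    quadratic part remains. *)
Lemma quadfun_ge0_form (R : realType) (n : nat) (P : 'M[R]_n) (p : 'cV[R]_n)
    (r : R) (y : 'cV[R]_n) : P^T = P -> quadfun P p r y = 0 ->
  (forall x, 0 <= quadfun P p r x) ->
  (forall x, quadfun P p r (y + x) = dot x (P *m x)) /\
  (forall x, 0 <= dot x (P *m x)).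
Proof.
move=> symP hy h0.
have shift x : quadfun P p r (y + x) = dot x (P *m x).
  have E s : 0 <= s * (2 * dot x (P *m y + p)) + s ^+ 2 * dot x (P *m x).
    by have := h0 (y + s *: x); rewrite quadfun_line// hy add0r.
  have -> : quadfun P p r (y + x) = 2 * dot x (P *m y + p) + dot x (P *m x).
    have := quadfun_line p r y x 1 symP.
    by rewrite scale1r hy add0r mul1r expr1n mul1r.
  move: E; move: (dot x (P *m x)) (2 * _) => e k E.
  suff -> : k = 0 by rewrite add0r.
  (* As [C > e], the choice [s = - k / C] gives the value [k^2 (e - C) / C^2], which is negative
     unless [k = 0]. *)
  pose C := 1 + `|e|; have C0 : 0 < C by rewrite ltr_wpDr.
  have := E (- k / C).
  have -> : - k / C * k + (- k / C) ^+ 2 * e = k ^+ 2 * (e - C) / C ^+ 2.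
    by field; rewrite gt_eqF.
  rewrite pmulr_lge0 ?invr_gt0 ?exprn_gt0//.
  have : e - C < 0 by have := ler_norm e; rewrite /C; lra.
  move=> eC; rewrite nmulr_lge0// => k2.
  by apply/eqP; rewrite -sqrf_eq0 eq_le k2 sqr_ge0.
by split=> // x; rewrite -shift.
Qed.

Theorem corollary1 (R : realType) (n : nat) (A B : 'M[R]_n) (a b : 'cV[R]_n)
    (c d : R) (symA : A^T = A) (symB : B^T = B)
    (h_feasible : exists x : 'cV[R]_n, quadfun B b d x = 0) :
  let f := quadfun A a c in
  let h := quadfun B b d in
  (forall x : 'cV[R]_n, h x = 0 -> 0 <= f x) <->
  (forall eps : R, 0 < eps ->
     exists lam : R, forall x : 'cV[R]_n,
       0 <= f x + lam * h x ^+ phi B + eps * ((x^T *m x) 0 0 + 1)).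
Proof.
move=> f h; split=> [hf eps eps0|hlam x hx]; last first.
  have N0 : 0 < dot x x + 1 by rewrite ltr_wpDl ?dotxx_ge0.
  rewrite leNgt; apply/negP => fx.
  (* This [eps] makes the last term [- f x / 2]; the power of [h x = 0] vanishes because [phi B] is
     positive, so the sum is [f x / 2 < 0]. *)
  have [|lam /(_ x)] := hlam (- f x / (2 * (dot x x + 1))).
    by rewrite divr_gt0 ?oppr_gt0// mulr_gt0.
  rewrite hx expr0n /phi (_ : (_ == 0)%N = false) ?mulr0 ?addr0; last by case: ifP.
  rewrite -/(dot x x).
  have -> : - f x / (2 * (dot x x + 1)) * (dot x x + 1) = - f x / 2.
    by field; rewrite gt_eqF.
  lra.
have [y hy] := h_feasible.
(* Common end of the semidefinite cases, used with [psi] equal to [h ^+ 2], [- h] and [h]: points of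
   [y + ker P] are zeros of [psi], hence of [h]. *)
have transl P (psi : 'cV[R]_n -> R) : P^T = P ->
    (forall x, psi (y + x) = dot x (P *m x)) ->
    (forall x, 0 <= dot x (P *m x)) -> (forall x, psi x = 0 -> h x = 0) ->
    exists lam, forall x, 0 <= f x + lam * psi x + eps * (dot x x + 1).
  move=> symP psiE psdP psi0.
  have fker u : P *m u = 0 -> 0 <= f (y + u).
    by move=> Pu; apply: hf; apply: psi0; rewrite psiE Pu /dot mulmx0 mxE.
  have [lam hl] := psd_penalty symA symP psdP fker eps0.
  by exists lam => x; have := hl (x - y); rewrite -psiE subrKC.
rewrite /phi; case: eqP => [B0|/eqP Bn0].
  (* With [B = 0], [h (y + x) = 2 b.x], whose square is the form of this rank-one matrix. *)
  pose P := 4 *: (b *m b^T).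
  have hE x : h (y + x) = 2 * dot b x.
    by move: hy; rewrite /h B0 !quadfunE !mul0mx dotDr /dot !mulmx0 mxE; lra.
  have PE x : dot x (P *m x) = h (y + x) ^+ 2.
    by rewrite hE /P -scalemxAl dotZr dot_outer; ring.
  apply: (transl P).
  - by rewrite linearZ /= trmx_mul trmxK.
  - by move=> x; rewrite PE.
  - by move=> x; rewrite PE sqr_ge0.
  - by move=> x /eqP; rewrite sqrf_eq0 => /eqP.
(* If [h] is nowhere positive, the argument is run on [- h] and the multiplier changes sign. *)
pose P' := - B; have symN : P'^T = P' by rewrite linearN /= symB.
have hN x : quadfun P' (- b) (- d) x = - h x.
  rewrite /h /P' !quadfunE mulNmx -!scaleN1r dotZr dotZl; ring.
have [hpos|/forallNP hnpos] := pselect (exists x, 0 < h x); last first.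
  have [||hE psdN] := quadfun_ge0_form (p := - b) (r := - d) (y := y) symN.
  - by rewrite hN /h hy oppr0.
  - by move=> x; rewrite hN oppr_ge0 leNgt; apply/negP/hnpos.
  have [||lam hl] := transl P' (fun x => - h x) symN _ psdN.
  - by move=> x; rewrite -hE hN.
  - by move=> x /eqP; rewrite oppr_eq0 => /eqP.
  by exists (- lam) => x; rewrite expr1 mulNr -mulrN.
have [hneg|/forallNP hnneg] := pselect (exists x, h x < 0).
  have [lam hl] := quadfun_indefinite symA symB Bn0 hf hpos hneg.
  exists lam => x; rewrite expr1 addr_ge0 ?hl// mulr_ge0 ?(ltW eps0)//.
  by rewrite addr_ge0// dotxx_ge0.
have [|hE psdB] := quadfun_ge0_form symB hy.
  by move=> x; rewrite leNgt; apply/negP/hnneg.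
by have [|lam hl] := transl B h symB hE psdB => //; exists lam.
Qed.
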